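(* For $\lambda>0$, let $u_{\lambda}\in\mathcal{C}^2([0,1])$ be the unique solution of $$-u_{\lambda}''(r)=\frac{\lambda\, e^{-u_{\lambda}(r)}}{\int_0^1 e^{-u_{\lambda}(s)}\,\mathrm{d}s},\quad r\in(0,1),\qquad u_{\lambda}(0)=u_{\lambda}'(0)=0.$$ Then, as $\lambda\to\infty$, $$u_{\lambda}(1)=2\log\frac1\lambda+2\log\pi-\frac4\lambda(1+o_\lambda).$$ Moreover, let $\alpha>0$ and $p>0$ be constants independent of $\lambda$, and put $r_{p,\alpha}^{\lambda}=1-\frac{p}{\lambda^\alpha}$ (for $\lambda$ large enough that $r_{p,\alpha}^\lambda\in(0,1)$). Then $u_\lambda(r_{p,\alpha}^\lambda)$ asymptotically blows up as $\lambda\to\infty$, in the following manner. (a) If $\alpha>2$, i.e. $\lambda^2\,\mathrm{dist}(r_{p,\alpha}^\lambda,1)\to0$, then $$u_\lambda(r_{p,\alpha}^\lambda)=-2\log\lambda+2\log\pi-\frac4\lambda(1+o_\lambda),$$ which shares the same first three terms with $u_\lambda(1)$; and $u_\lambda'(r_{p,\alpha}^\lambda)$ and $u_\lambda'(1)$ share the same leading order term, which asymptotically blows up. In particular, $|u_\lambda'(r_{p,\alpha}^\lambda)-u_\lambda'(1)|\to0$ as $\lambda\to\infty$. (b) If $1<\alpha\le2$, then: (b1) $u_\lambda(r_{p,\alpha}^\lambda)$ and $u_\lambda(1)$ share the same first two terms: $$u_\lambda(r_{p,\alpha}^\lambda)=2\log\frac1\lambda+2\log\pi+\begin{cases}\dfrac{p-4}{\lambda}(1+o_\lambda)&\text{if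 }\alpha=2,\\[2mm]\dfrac{p}{\lambda^{\alpha-1}}(1+o_\lambda)&\text{if }\alpha\in(1,2).\end{cases}$$ (b2) $u_\lambda'(r_{p,\alpha}^\lambda)$ and $u_\lambda'(1)$ share the same leading order term: $$u_\lambda'(r_{p,\alpha}^\lambda)=-\lambda+\frac p2\lambda^{2-\alpha}(1+o_\lambda),\quad \alpha\in(1,2].$$ Hence the effect of $p$ and $\alpha$ occurs at the third order term of $u_\lambda(r_{p,\alpha}^\lambda)$ and the second order term of $u_\lambda'(r_{p,\alpha}^\lambda)$. (c) If $\alpha=1$, then: (c1) $u_\lambda(r_{p,\alpha}^\lambda)$ and $u_\lambda(1)$ share the same leading order term: $$u_\lambda(r_{p,\alpha}^\lambda)=2\log\frac1\lambda+2\log\frac{(p+2)\pi}{2}-\frac4\lambda(1+o_\lambda).$$ (c2) The leading order term of $u_\lambda'(r_{p,\alpha}^\lambda)$ depends on $p$: $$u_\lambda'(r_{p,\alpha}^\lambda)=-\frac{2}{p+2}\lambda+o_\lambda.$$ Hence the effect of $p$ occurs at the second order term of $u_\lambda(r_{p,\alpha}^\lambda)$ and the leading order term of $u_\lambda'(r_{p,\alpha}^\lambda)$. (d) If $0<\alpha<1$, then: (d1) The leading order term of $u_\lambda(r_{p,\alpha}^\lambda)$ depends on $\alpha$ and the second order term depends on $p$: $$u_\lambda(r_{p,\alpha}^\lambda)=2\alpha\log\frac1\lambda+2\log\frac{p\pi}{2}+o_\lambda.$$ (d2) The leading order term of $u_\lambda'(r_{p,\alpha}^\lambda)$ depends on $p$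 and $\alpha$: $$u_\lambda'(r_{p,\alpha}^\lambda)=-\frac2p\lambda^\alpha+o_\lambda.$$
   Context: $o_\lambda$ denotes a quantity (possibly different at each occurrence) tending to $0$ as $\lambda\to\infty$. Existence and uniqueness of the $\mathcal{C}^2([0,1])$ solution $u_\lambda$ for every $\lambda>0$ is a known fact and is taken as given. Integrating the equation over $(0,1)$ gives $u_\lambda'(1)=-\lambda$.
   Formalization: (d2) as printed fails for 1/2 ≤ α < 1 (next term (4/p²)λ^{2α−1}): additive o_λ is stated for α < 1/2, and −(2/p)λ^α(1+o_λ) for all α < 1. In (b1) with α = 2, p = 4 the printed form is false; the remainder is o_λ/λ instead. *)

(* Defs.v *)
From Stdlib Require Export Reals.
From Coquelicot Require Export Coquelicot.
Open Scope R_scope.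

Definition I01 (r : R) : Prop := 0 <= r <= 1.

(** [u] is of class C^2 on the closed interval, with first and second
    derivatives [u'] and [u'']; [D_in] and [continue_in] are relative to [0,1],
    so they are one-sided at 0 and 1 and ignore values outside [0,1]. *)
Definition C2_on_I01 (u u' u'' : R -> R) : Prop :=
  forall r, I01 r ->
    D_in u u' I01 r /\ D_in u' u'' I01 r /\ continue_in u'' I01 r.

Definition is_solution (lambda : R) (u u' : R -> R) : Prop :=
  exists u'' : R -> R,
    C2_on_I01 u u' u'' /\
    (forall r, 0 < r < 1 ->
       - u'' r = lambda * exp (- u r) / RInt (fun s => exp (- u s)) 0 1) /\
    u 0 = 0 /\ u' 0 = 0.

(** [with_o (fun l o => E)] reads "E holds as l -> +oo, where o = o_l denotes
    some quantity tending to 0". *)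
Definition with_o (E : R -> R -> Prop) : Prop :=
  exists o : R -> R,
    is_lim o p_infty 0 /\ Rbar_locally p_infty (fun l => E l (o l)).

Definition tends_to_0 (f : R -> R) : Prop := is_lim f p_infty 0.

Definition blows_up (f : R -> R) : Prop :=
  is_lim (fun l => Rabs (f l)) p_infty p_infty.

Definition same_leading_term (f g : R -> R) : Prop :=
  is_lim (fun l => f l / g l) p_infty 1.

Definition r_pt (p alpha lambda : R) : R := 1 - p / Rpower lambda alpha.

(* Main.v *)
(** Writing the equation as [u'' = - 2 k^2 exp (- u)], the energy
    [u'^2 - 4 k^2 exp (- u)] is conserved, so [w = exp (u / 2)] solves the linear
    equation [w'' = - k^2 w] and [u = 2 ln (cos (k r))], [u' = - 2 k tan (k r)] with
    [2 k tan k = lambda] and [0 < k < PI / 2].  The defect [d = PI / 2 - k] satisfies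
    [lambda d = PI - 2 PI / lambda + o (1 / lambda)].  At distance [q] from the
    boundary, [u = 2 ln (sin t)] and [u' = - 2 k cot t] with [t = d + k q], and every
    expansion follows from that of [t], because [sin t / t] and [t cot t] differ from
    [1] by at most [t^2 / 2]. *)
Require Import Defs.
From Stdlib Require Import Reals Lra.
From Coquelicot Require Import Coquelicot.
Open Scope R_scope.

(** * The explicit solution *)

(** The equation is nonlocal: its coefficient contains the integral of [exp (- u)]. That integral is
    frozen as a constant, which defines [k]; recomputing it from the explicit solution gives
    [tan k / k], and this self-consistency is the relation [2 k tan k = lambda]. The bound
    [k < PI / 2] is forced because [cos (k r) = exp (u / 2)] cannot vanish on the interval. In terms
    of the defect the relation reads [lambda sin d = 2 k cos d] with [2 k = PI - 2 d], so [lambda d]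
    is [PI - 2 d] up to a relative error of order [d^2]. Since [d] is close to [PI / lambda], the
    correction is [- 2 PI / lambda], and the constant [- 4] of the theorem is [2 (- 2 PI) / PI].
    Expansions are proved as limits of scaled errors [a (f - main term)], which combine by the
    algebra of limits; the quantities [o] are read off from these limits only at the end. *)

Definition clamp (x : R) : R := Rmax 0 (Rmin x 1).

Lemma clamp_I01 (x : R) : I01 (clamp x).
Proof.
  unfold clamp, I01, Rmax, Rmin.
  repeat destruct Rle_dec; lra.
Qed.

Lemma clamp_id (x : R) : I01 x -> clamp x = x.
Proof.
  unfold clamp, I01, Rmax, Rmin; intros [H0 H1].
  repeat destruct Rle_dec; lra.
Qed.

Lemma clamp_lipschitz (x y : R) : Rabs (clamp x - clamp y) <= Rabs (x - y).
Proof.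
  unfold clamp, Rmax, Rmin.
  repeat destruct Rle_dec; unfold Rabs; repeat destruct Rcase_abs; lra.
Qed.

(** The retraction [clamp] is 1-Lipschitz, so it turns continuity relative to [0,1] into continuity
    on the whole line, the form that the mean value theorem and the integral lemmas expect. *)
Lemma continuous_comp_clamp (f : R -> R) :
  (forall r, I01 r -> continue_in f I01 r) ->
  forall x, continuous (fun t => f (clamp t)) x.
Proof.
  intros Hf x.
  apply continuity_pt_filterlim.
  intros eps Heps.
  destruct (Hf (clamp x) (clamp_I01 x) eps Heps) as [a [Ha Hlim]].
  exists a; split; [exact Ha|].
  intros y [_ Hy]; simpl in *; unfold Rdist in *.
  (* [continue_in] speaks only of points different from the limit point, so points with the same
     image under [clamp] are treated apart. *)
  destruct (Req_dec (clamp y) (clamp x)) as [E|E].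
  - rewrite E, Rminus_diag, Rabs_R0; exact Heps.
  - apply Hlim; split.
    + split; [apply clamp_I01 | intros E'; apply E; symmetry; exact E'].
    + eapply Rle_lt_trans; [apply clamp_lipschitz | exact Hy].
Qed.

Lemma is_derive_comp_clamp (f f' : R -> R) (x : R) :
  0 < x < 1 -> D_in f f' I01 x -> is_derive (fun t => f (clamp t)) x (f' x).
Proof.
  intros Hx HD.
  apply is_derive_Reals.
  intros eps Heps.
  destruct (HD eps Heps) as [a [Ha Hlim]].
  assert (Hd : 0 < Rmin a (Rmin x (1 - x))) by (repeat apply Rmin_glb_lt; lra).
  exists (mkposreal _ Hd); simpl.
  intros h Hh0 Hh.
  pose proof (Rmin_l a (Rmin x (1 - x))).
  pose proof (Rmin_r a (Rmin x (1 - x))).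
  pose proof (Rmin_l x (1 - x)).
  pose proof (Rmin_r x (1 - x)).
  assert (Hb : - Rmin x (1 - x) < h < Rmin x (1 - x))
    by (apply Rabs_def2 in Hh; lra).
  assert (I1 : I01 (x + h)) by (unfold I01; lra).
  assert (I2 : I01 x) by (unfold I01; lra).
  rewrite (clamp_id _ I1), (clamp_id _ I2).
  specialize (Hlim (x + h)); simpl in Hlim; unfold Rdist in Hlim.
  replace (x + h - x) with h in Hlim by ring.
  apply Hlim; split; [split; [exact I1 | lra] | lra].
Qed.

(** The derivative is known only in the open interval, where the equation holds; continuity carries
    the conclusion to the end points. *)
Lemma constant_of_derive_0 (f : R -> R) :
  (forall x, continuous f x) -> (forall x, 0 < x < 1 -> is_derive f x 0) ->
  forall x, I01 x -> f x = f 0.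
Proof.
  intros Hc Hd x [H0 H1].
  destruct (MVT_gen f 0 x (fun _ => 0)) as [c [_ E]].
  - rewrite Rmin_left, Rmax_right by lra; intros t Ht; apply Hd; lra.
  - intros t _; apply continuity_pt_filterlim, Hc.
  - lra.
Qed.

Ltac cont :=
  match goal with
  | |- continuous (fun x => _ + _) _ =>
      apply (continuous_plus (V := R_NormedModule)); cont
  | |- continuous (fun x => _ - _) _ =>
      apply (continuous_minus (V := R_NormedModule)); cont
  | |- continuous (fun x => _ * _) _ =>
      apply (continuous_mult (K := R_AbsRing)); cont
  | H : forall x, continuous ?f x |- continuous ?f _ => apply H
  | |- _ => apply continuous_const
  end.

(** [auto_derive] leaves the derivative of an abstract function as a [Derive] term; this substitutes
    the value known from [D]. *)
Ltac derive_value D :=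
  match type of D with
  | is_derive ?f ?x ?l =>
      replace (Derive (fun y => f y) x) with l
        by (symmetry; apply is_derive_unique, D)
  end.

(** No uniqueness theorem for differential equations is invoked. For [w = exp (v / 2)] and [z = w'],
    rotating the vector [(w, z / k)] by the angle [k x] cancels its motion, so both rotated
    coordinates are constant and are read off at 0. *)
Lemma liouville_solution (v v' : R -> R) (k : R) :
  0 < k ->
  (forall x, continuous v x) -> (forall x, continuous v' x) ->
  (forall x, 0 < x < 1 -> is_derive v x (v' x)) ->
  (forall x, 0 < x < 1 -> is_derive v' x (- (2 * k ^ 2) * exp (- v x))) ->
  v 0 = 0 -> v' 0 = 0 ->
  forall x, I01 x ->
    exp (v x / 2) = cos (k * x) /\ v' x * exp (v x / 2) = - (2 * k) * sin (k * x).
Proof.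
  intros Hk Cv Cv' Dv Dv' v0 v'0.
  assert (Cf : forall (f g : R -> R), (forall x, continuous f x) ->
            (forall x, ex_derive g x) -> forall x, continuous (fun t => g (f t)) x).
  { intros f g Hf Hg x.
    apply (continuous_comp f g); [apply Hf|].
    apply (ex_derive_continuous (K := R_AbsRing) (V := R_NormedModule)), Hg. }
  assert (Ce : forall x, continuous (fun t => exp (- v t)) x).
  { apply (Cf v (fun y => exp (- y)) Cv); intros; auto_derive; trivial. }
  assert (Cw : forall x, continuous (fun t => exp (v t / 2)) x).
  { apply (Cf v (fun y => exp (y / 2)) Cv); intros; auto_derive; trivial. }
  assert (Cc : forall x, continuous (fun t => cos (k * t)) x).
  { apply (Cf (fun t => t) (fun y => cos (k * y)));
      intros; [apply continuous_id | auto_derive; trivial]. }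
  assert (Cs : forall x, continuous (fun t => sin (k * t)) x).
  { apply (Cf (fun t => t) (fun y => sin (k * y)));
      intros; [apply continuous_id | auto_derive; trivial]. }
  assert (energy : forall x, I01 x -> (v' x) ^ 2 = 4 * k ^ 2 * (exp (- v x) - 1)).
  { intros x Hx.
    assert (E : v' x * v' x - 4 * k ^ 2 * exp (- v x)
                = v' 0 * v' 0 - 4 * k ^ 2 * exp (- v 0)).
    { apply (constant_of_derive_0
               (fun t => v' t * v' t - 4 * k ^ 2 * exp (- v t))); [| |exact Hx].
      - intros t; cont.
      - intros t Ht.
        pose proof (Dv t Ht) as D1; pose proof (Dv' t Ht) as D2.
        auto_derive.
        + repeat split; eexists; eassumption.
        + derive_value D1; derive_value D2; ring. }
    rewrite v0, v'0, Ropp_0, exp_0 in E; lra. }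
  set (w := fun t => exp (v t / 2)).
  set (z := fun t => v' t * exp (v t / 2) / 2).
  assert (Cw' : forall x, continuous w x) by exact Cw.
  assert (Dw : forall x, 0 < x < 1 ->
    is_derive w x (z x)).
  { intros y Hy; pose proof (Dv y Hy) as D1; unfold w, z; auto_derive.
    - eexists; eassumption.
    - derive_value D1; unfold Rdiv; ring. }
  assert (Dz : forall x, 0 < x < 1 ->
    is_derive z x (- k ^ 2 * w x)).
  { intros x Hx; pose proof (Dv x Hx) as D1; pose proof (Dv' x Hx) as D2.
    unfold w, z; auto_derive.
    - repeat split; eexists; eassumption.
    - derive_value D1; derive_value D2.
      replace (v x * / 2) with (v x / 2) by reflexivity.
      assert (Hx' : I01 x) by (unfold I01; lra).
      pose proof (energy x Hx') as E.
      (* The energy identity turns [v'^2 / 4] into [k^2 (exp (- v) - 1)]; the exponentials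
         [exp (- v)] cancel and only the linear term [- k^2 w] is left. *)
      transitivity ((- (k ^ 2) * exp (- v x) + (v' x) ^ 2 / 4) * exp (v x / 2));
        [field | rewrite E; field]. }
  assert (Cz : forall x, continuous z x) by (intros x; unfold z, Rdiv; cont).
  intros x Hx.
  (* [A] and [B] are the two coordinates of the rotated vector, with values 1 and 0; the inverse
     rotation then gives [Ew] and [Ez]. *)
  assert (A : w x * cos (k * x) - z x * sin (k * x) * / k
              = w 0 * cos (k * 0) - z 0 * sin (k * 0) * / k).
  { apply (constant_of_derive_0
             (fun t => w t * cos (k * t) - z t * sin (k * t) * / k)); [| |exact Hx].
    - intros t; cont.
    - intros t Ht; pose proof (Dw t Ht) as D1; pose proof (Dz t Ht) as D2.
      auto_derive.
      + repeat split; eexists; eassumption.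
      + derive_value D1; derive_value D2.
        unfold z, w; field; lra. }
  assert (B : w x * sin (k * x) + z x * cos (k * x) * / k
              = w 0 * sin (k * 0) + z 0 * cos (k * 0) * / k).
  { apply (constant_of_derive_0
             (fun t => w t * sin (k * t) + z t * cos (k * t) * / k)); [| |exact Hx].
    - intros t; cont.
    - intros t Ht; pose proof (Dw t Ht) as D1; pose proof (Dz t Ht) as D2.
      auto_derive.
      + repeat split; eexists; eassumption.
      + derive_value D1; derive_value D2.
        unfold z, w; field; lra. }
  assert (w0 : w 0 = 1) by (unfold w; rewrite v0; unfold Rdiv; rewrite Rmult_0_l; apply exp_0).
  assert (z0 : z 0 = 0) by (unfold z; rewrite v'0; field).
  rewrite w0, z0, Rmult_0_r, cos_0, sin_0 in A, B.
  pose proof (sin2_cos2 (k * x)) as P; unfold Rsqr in P.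
  set (c := cos (k * x)) in *; set (s := sin (k * x)) in *.
  assert (Ew : w x = c).
  { transitivity (c * (w x * c - z x * s * / k) + s * (w x * s + z x * c * / k)).
    - transitivity (w x * (s * s + c * c)); [rewrite P|]; ring.
    - rewrite A, B; ring. }
  assert (Ez : z x = - k * s).
  { transitivity (k * (c * (w x * s + z x * c * / k) - s * (w x * c - z x * s * / k))).
    - transitivity (z x * (s * s + c * c)); [rewrite P; ring | field; lra].
    - rewrite A, B; ring. }
  split; [exact Ew|].
  unfold z in Ez; lra.
Qed.

(* [k] with [2 k^2 = lambda / int exp(-u)], so that the equation reads
   [u'' = - 2 k^2 exp(-u)]. *)
Definition freq (lambda : R) (u : R -> R) : R :=
  sqrt (lambda / RInt (fun s => exp (- u s)) 0 1 / 2).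

Lemma solution_formula (lambda : R) (u u' : R -> R) :
  0 < lambda -> is_solution lambda u u' ->
  let k := freq lambda u in
  0 < k < PI / 2 /\ 2 * k * sin k = lambda * cos k /\
  forall r, I01 r ->
    0 < cos (k * r) /\ u r = 2 * ln (cos (k * r)) /\
    u' r = - (2 * k) * (sin (k * r) / cos (k * r)).
Proof.
  intros Hl (u'' & HC & Heq & u0 & u'0) k.
  set (J := RInt (fun s => exp (- u s)) 0 1) in *.
  (* The derivatives of [u] are one-sided at 0 and 1 and its values outside [0,1] are arbitrary; [v]
     and [v'] are continuous extensions that agree with [u] and [u'] on [0,1]. *)
  set (v := fun t => u (clamp t)).
  set (v' := fun t => u' (clamp t)).
  assert (Cv : forall x, continuous v x).
  { apply continuous_comp_clamp; intros r Hr.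
    apply cont_deriv with u', HC, Hr. }
  assert (Cv' : forall x, continuous v' x).
  { apply continuous_comp_clamp; intros r Hr.
    apply cont_deriv with u'', HC, Hr. }
  assert (Hopen : forall x, 0 < x < 1 -> I01 x) by (unfold I01; intros; lra).
  assert (Ev : forall x, I01 x -> v x = u x)
    by (intros; unfold v; rewrite clamp_id; auto).
  assert (Ev' : forall x, I01 x -> v' x = u' x)
    by (intros; unfold v'; rewrite clamp_id; auto).
  assert (I0 : I01 0) by (unfold I01; lra).
  assert (I1 : I01 1) by (unfold I01; lra).
  assert (HJv : J = RInt (fun s => exp (- v s)) 0 1).
  { apply RInt_ext; intros x; rewrite Rmin_left, Rmax_right by lra; intros Hx.
    rewrite Ev; auto. }
  assert (HJ : 0 < J).
  { rewrite HJv; apply RInt_gt_0; [lra | intros; apply exp_pos |].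
    intros x _; apply (continuous_comp v (fun y => exp (- y))); [apply Cv|].
    apply (ex_derive_continuous (K := R_AbsRing) (V := R_NormedModule)).
    auto_derive; trivial. }
  assert (HK : 0 < lambda / J / 2) by (repeat apply Rdiv_lt_0_compat; lra).
  assert (Hk : 0 < k) by (apply sqrt_lt_R0, HK).
  assert (Ek : 2 * k ^ 2 = lambda / J).
  { unfold k, freq; fold J; simpl; rewrite Rmult_1_r, sqrt_sqrt; lra. }
  assert (Hsol : forall x, I01 x -> exp (u x / 2) = cos (k * x) /\
                   u' x * exp (u x / 2) = - (2 * k) * sin (k * x)).
  { intros x Hx; rewrite <- Ev, <- Ev' by exact Hx.
    apply liouville_solution; auto.
    - intros y Hy; rewrite Ev' by auto.
      apply is_derive_comp_clamp; [exact Hy | apply HC; auto].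
    - intros y Hy; rewrite Ev by auto.
      replace (- (2 * k ^ 2) * exp (- u y)) with (u'' y).
      + apply is_derive_comp_clamp; [exact Hy | apply HC; auto].
      + rewrite Ek; pose proof (Heq y Hy) as E.
        unfold Rdiv in E |- *; lra.
    - rewrite Ev; auto.
    - rewrite Ev'; auto. }
  assert (Hcos : forall x, I01 x -> 0 < cos (k * x)).
  { intros x Hx; destruct (Hsol x Hx) as [<- _]; apply exp_pos. }
  assert (Hk2 : k < PI / 2).
  { destruct (Rlt_or_le k (PI / 2)) as [h|h]; [exact h|exfalso].
    pose proof PI_RGT_0.
    (* If [k >= PI / 2], this point lies in [0,1] and is a zero of [cos (k x)], against [Hcos]. *)
    assert (Hx : I01 (PI / 2 / k)).
    { split; [apply Rlt_le, Rdiv_lt_0_compat; lra|].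
      apply Rmult_le_reg_r with k; [exact Hk|].
      unfold Rdiv at 1; rewrite Rmult_assoc, Rinv_l; lra. }
    pose proof (Hcos _ Hx) as P.
    replace (k * (PI / 2 / k)) with (PI / 2) in P by (field; lra).
    rewrite cos_PI2 in P; lra. }
  assert (Ck : 0 < cos k) by (rewrite <- (Rmult_1_r k); apply Hcos, I1).
  split; [split; assumption | split].
  (* [tan (k s) / k] is a primitive of [1 / cos (k s)^2 = exp (- u s)]; comparing with
     [2 k^2 = lambda / J] closes the relation for [k]. *)
  - assert (HJk : J = sin k / cos k / k).
    { transitivity (RInt (fun s => / (cos (k * s)) ^ 2) 0 1).
      - apply RInt_ext; intros x; rewrite Rmin_left, Rmax_right by lra; intros Hx.
        destruct (Hsol x (Hopen x Hx)) as [<- _].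
        simpl; rewrite Rmult_1_r, <- exp_plus, <- exp_Ropp; f_equal; field.
      - apply is_RInt_unique.
        replace (sin k / cos k / k) with
          (minus (sin (k * 1) / cos (k * 1) / k) (sin (k * 0) / cos (k * 0) / k)).
        + apply (is_RInt_derive (V := R_CompleteNormedModule)
            (fun s => sin (k * s) / cos (k * s) / k)).
          * intros x; rewrite Rmin_left, Rmax_right by lra; intros Hx.
            pose proof (Hcos x Hx).
            auto_derive; [lra|].
            pose proof (sin2_cos2 (k * x)) as P; unfold Rsqr in P.
            transitivity ((sin (k * x) * sin (k * x) + cos (k * x) * cos (k * x))
                          / cos (k * x) ^ 2); [field; lra | rewrite P; field; lra].
          * intros x; rewrite Rmin_left, Rmax_right by lra; intros Hx.
            pose proof (Hcos x Hx).
            apply (ex_derive_continuous (K := R_AbsRing) (V := R_NormedModule)).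
            auto_derive.
            apply Rgt_not_eq; repeat apply Rmult_lt_0_compat; lra.
        + unfold minus, plus, opp; simpl.
          rewrite Rmult_1_r, Rmult_0_r, sin_0, cos_0; field; lra. }
    transitivity (2 * k ^ 2 * J * cos k).
    + rewrite HJk; field; lra.
    + rewrite Ek; field; lra.
  - intros r Hr; destruct (Hsol r Hr) as [E1 E2].
    pose proof (Hcos r Hr).
    split; [assumption | split].
    + rewrite <- E1, ln_exp; field.
    + rewrite E1 in E2; apply Rmult_eq_reg_r with (cos (k * r)); [|lra].
      rewrite E2; field; lra.
Qed.

(** * Limits at infinity *)

(** The mean value theorem gives [sin x = x cos c] with [c <= x], and the cosine decreases; the
    bound on the cosine is the half-angle formula with [sin (x / 2) < x / 2]. *)
Lemma sin_cos_bounds (x : R) :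
  0 < x < PI / 2 -> x * cos x <= sin x <= x /\ 1 - x ^ 2 / 2 <= cos x.
Proof.
  intros Hx; split; [split|].
  - destruct (MVT_gen sin 0 x cos) as [c [Hc E]].
    + intros t _; auto_derive; [trivial | ring].
    + intros t _; apply continuity_sin.
    + rewrite Rmin_left, Rmax_right in Hc by lra.
      rewrite sin_0 in E.
      assert (cos x <= cos c) by (apply cos_decr_1; lra).
      replace (sin x) with (cos c * x) by lra.
      rewrite Rmult_comm; apply Rmult_le_compat_r; lra.
  - apply Rlt_le, sin_lt_x; lra.
  - replace (cos x) with (1 - 2 * sin (x / 2) * sin (x / 2))
      by (rewrite <- cos_2a_sin; f_equal; field).
    assert (0 < sin (x / 2)) by (apply sin_gt_0; lra).
    assert (sin (x / 2) < x / 2) by (apply sin_lt_x; lra).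
    nra.
Qed.

Lemma eventually_gt (M : R) : Rbar_locally p_infty (fun l => M < l).
Proof. exists M; auto. Qed.

Lemma lim_ext (f g : R -> R) (a b : R) :
  is_lim f p_infty a -> Rbar_locally p_infty (fun l => f l = g l) -> a = b ->
  is_lim g p_infty b.
Proof. intros Hf E <-; exact (is_lim_ext_loc f g p_infty a E Hf). Qed.

Lemma lim_opp (f : R -> R) (a : R) :
  is_lim f p_infty a -> is_lim (fun l => - f l) p_infty (- a).
Proof. apply (is_lim_opp f p_infty a). Qed.

Lemma lim_minus (f g : R -> R) (a b : R) :
  is_lim f p_infty a -> is_lim g p_infty b ->
  is_lim (fun l => f l - g l) p_infty (a - b).
Proof. intros Hf Hg; exact (is_lim_plus' f _ _ _ _ Hf (lim_opp g b Hg)). Qed.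

Lemma lim_mult (f g : R -> R) (a b : R) :
  is_lim f p_infty a -> is_lim g p_infty b ->
  is_lim (fun l => f l * g l) p_infty (a * b).
Proof. intros Hf Hg; exact (is_lim_mult f g _ _ _ Hf Hg I). Qed.

Lemma lim_div (f g : R -> R) (a b : R) :
  is_lim f p_infty a -> is_lim g p_infty b -> b <> 0 ->
  is_lim (fun l => f l / g l) p_infty (a / b).
Proof.
  intros Hf Hg Hb; apply lim_mult; [exact Hf|].
  apply (is_lim_inv g p_infty b Hg); congruence.
Qed.

Lemma lim_squeeze (f g h : R -> R) (a : R) :
  Rbar_locally p_infty (fun l => f l <= g l <= h l) ->
  is_lim f p_infty a -> is_lim h p_infty a -> is_lim g p_infty a.
Proof. exact (is_lim_le_le_loc f h g p_infty a). Qed.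

Lemma lim_eventually_pos (f : R -> R) (a : R) :
  is_lim f p_infty a -> 0 < a -> Rbar_locally p_infty (fun l => 0 < f l).
Proof.
  intros Hf Ha.
  apply Hf.
  exists (mkposreal a Ha); simpl; intros y Hy.
  apply Rabs_def2 in Hy; unfold minus, plus, opp in Hy; simpl in Hy; lra.
Qed.

Lemma lim_eventually_lt (f : R -> R) (a b : R) :
  is_lim f p_infty a -> a < b -> Rbar_locally p_infty (fun l => f l < b).
Proof.
  intros Hf Hab.
  apply (filter_imp (fun l => 0 < b - f l)); [intros; lra|].
  apply lim_eventually_pos with (b - a); [|lra].
  apply lim_minus; [apply is_lim_const | exact Hf].
Qed.

Lemma lim_value (f : R -> R) (a b : R) :
  is_lim f p_infty a -> a = b -> is_lim f p_infty b.
Proof. intros Hf <-; exact Hf. Qed.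

(** The limit is an existential variable built up by the recursion, and each quotient leaves the
    goal that its denominator has a nonzero limit. Hypotheses are tried before any decomposition, so
    a product such as [l * defect k l], with a divergent factor, is used as one block when its limit
    is known. *)
Ltac lim :=
  match goal with
  | H : is_lim ?f p_infty _ |- is_lim ?f p_infty _ => exact H
  | |- is_lim (fun _ => ?c) p_infty _ => apply is_lim_const
  | |- is_lim (fun l => _ + _) p_infty _ => eapply is_lim_plus'; lim
  | |- is_lim (fun l => _ - _) p_infty _ => eapply lim_minus; lim
  | |- is_lim (fun l => - _) p_infty _ => eapply lim_opp; lim
  | |- is_lim (fun l => _ * _) p_infty _ => eapply lim_mult; lim
  | |- is_lim (fun l => _ / _) p_infty _ => eapply lim_div; [lim | lim |]
  | |- is_lim _ p_infty _ => eassumption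
  end.

Ltac lim_here := eapply lim_value; [lim |].

(* [lim_as e] proves a limit by computing that of the eventually equal
   expression [e] term by term. *)
Tactic Notation "lim_as" uconstr(e) := eapply (lim_ext e); [lim | |].

Lemma lim_Rpower (a : R) :
  0 < a -> is_lim (fun l => Rpower l a) p_infty p_infty.
Proof.
  intros Ha.
  apply (is_lim_comp exp (fun l => a * ln l) p_infty p_infty p_infty).
  - apply is_lim_exp_p.
  - replace p_infty with (Rbar_mult a p_infty) at 2.
    + apply is_lim_scal_l, is_lim_ln_p.
    + simpl; case Rle_dec; intros h; [|lra].
      case Rle_lt_or_eq_dec; intros; [reflexivity|lra].
  - exists 0; intros; discriminate.
Qed.

Lemma lim_inv_infty (f : R -> R) :
  is_lim f p_infty p_infty -> is_lim (fun l => / f l) p_infty 0.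
Proof. intros Hf; apply (is_lim_inv f p_infty p_infty Hf); discriminate. Qed.

Lemma lim_Rpower_neg (a : R) : a < 0 -> is_lim (fun l => Rpower l a) p_infty 0.
Proof.
  intros Ha.
  apply (is_lim_ext (fun l => / Rpower l (- a))).
  - intros l; rewrite Rpower_Ropp, Rinv_inv; reflexivity.
  - apply lim_inv_infty, lim_Rpower; lra.
Qed.

Lemma Rpower_pos (x a : R) : 0 < Rpower x a.
Proof. apply exp_pos. Qed.

(** From [1 - 1 / z <= ln z <= z - 1]: after multiplication by [a], the two bounds differ by the
    factor [1 / z], which tends to 1. *)
Lemma lim_scaled_ln (a z : R -> R) (c : R) :
  is_lim a p_infty p_infty -> is_lim (fun l => a l * (z l - 1)) p_infty c ->
  is_lim (fun l => a l * ln (z l)) p_infty c.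
Proof.
  intros Ha Hz.
  assert (Ha0 : Rbar_locally p_infty (fun l => 0 < a l)).
  { apply Ha; exists 0; auto. }
  pose proof (lim_inv_infty a Ha) as Hi.
  (* [z - 1] is the convergent quantity [a (z - 1)] divided by the divergent [a]. *)
  assert (Hz1 : is_lim z p_infty 1).
  { lim_as (fun l => 1 + (a l * (z l - 1)) * / a l); [|ring].
    apply (filter_imp _ _) with (2 := Ha0); intros l Hl; field; lra. }
  assert (Hz0 : Rbar_locally p_infty (fun l => 0 < z l))
    by (apply lim_eventually_pos with 1; [exact Hz1|lra]).
  assert (ln_le_minus : forall y, 0 < y -> ln y <= y - 1).
  { intros y Hy; pose proof (exp_ineq1_le (ln y)) as E.
    rewrite exp_ln in E; lra. }
  apply (lim_squeeze (fun l => a l * (z l - 1) / z l) _ (fun l => a l * (z l - 1))).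
  - apply (filter_imp (fun l => 0 < a l /\ 0 < z l)); [|apply filter_and; assumption].
    intros l [A Z]; split.
    + assert (1 - / z l <= ln (z l)).
      { pose proof (ln_le_minus (/ z l) (Rinv_0_lt_compat _ Z)) as E.
        rewrite ln_Rinv in E; lra. }
      replace (a l * (z l - 1) / z l) with (a l * (1 - / z l)) by (field; lra).
      apply Rmult_le_compat_l; lra.
    + apply Rmult_le_compat_l; [lra | apply ln_le_minus, Z].
  - lim_here; [lra | field].
  - exact Hz.
Qed.

Lemma eventually_small_angle (t : R -> R) :
  Rbar_locally p_infty (fun l => 0 < t l) -> is_lim t p_infty 0 ->
  Rbar_locally p_infty (fun l => 0 < t l < PI / 2).
Proof.
  intros Hpos Ht; apply filter_and; [exact Hpos|].
  apply lim_eventually_lt with 0; [exact Ht | pose proof PI_RGT_0; lra].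
Qed.

(** Since [t - t^3 / 2 <= sin t <= t], replacing [t] by [sin t] costs at most [(s t) (a t^2) / 2], a
    bounded factor times a vanishing one. Here [s] is the scale of the angle and [a] the precision
    at which the error is measured. *)
Lemma lim_scaled_sin (a s t : R -> R) (C L : R) :
  Rbar_locally p_infty (fun l => 0 < t l) ->
  Rbar_locally p_infty (fun l => 0 < a l /\ 0 < s l) ->
  is_lim t p_infty 0 -> is_lim (fun l => s l * t l) p_infty C ->
  is_lim (fun l => a l * t l * t l) p_infty 0 ->
  is_lim (fun l => a l * (s l * t l - C)) p_infty L ->
  is_lim (fun l => a l * (s l * sin (t l) - C)) p_infty L.
Proof.
  intros Hpos Has Ht Hst Hat HL.
  apply (lim_squeeze
    (fun l => a l * (s l * t l - C) - (s l * t l) * (a l * t l * t l) * / 2) _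
    (fun l => a l * (s l * t l - C))).
  - apply (filter_imp (fun l => (0 < t l < PI / 2) /\ 0 < a l /\ 0 < s l));
      [|apply filter_and; [apply eventually_small_angle|]; assumption].
    intros l [T [A S]].
    destruct (sin_cos_bounds _ T) as [[B1 B2] B3].
    assert (AS : 0 < a l * s l) by (apply Rmult_lt_0_compat; assumption).
    assert (t l - t l * t l * t l / 2 <= sin (t l)) by nra.
    split.
    + apply Rle_trans with (a l * s l * (t l - t l * t l * t l / 2) - a l * C);
        [apply Req_le; field|].
      apply Rle_trans with (a l * s l * sin (t l) - a l * C); [|apply Req_le; ring].
      apply Rplus_le_compat_r, Rmult_le_compat_l; lra.
    + apply Rmult_le_compat_l; [lra|].
      apply Rplus_le_compat_r, Rmult_le_compat_l; lra.
  - lim_here; ring.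
  - exact HL.
Qed.

Lemma lim_sin (s t : R -> R) (C : R) :
  Rbar_locally p_infty (fun l => 0 < t l) ->
  Rbar_locally p_infty (fun l => 0 < s l) ->
  is_lim t p_infty 0 -> is_lim (fun l => s l * t l) p_infty C ->
  is_lim (fun l => s l * sin (t l)) p_infty C.
Proof.
  intros Hpos Hs Ht Hst.
  assert (H : is_lim (fun l => 1 * (s l * sin (t l) - C)) p_infty 0).
  { apply lim_scaled_sin; try assumption.
    - apply (filter_imp _ _) with (2 := Hs); intros; lra.
    - lim_here; ring.
    - lim_here; ring. }
  lim_as (fun l => 1 * (s l * sin (t l) - C) + C);
    [apply filter_forall; intros; ring | ring].
Qed.

(** The difference lies between [- t / 2] and 0: the upper bound is [t cos t <= sin t], the lower
    one combines [sin t <= t] with [cos t >= 1 - t^2 / 2]. *)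
Lemma lim_cot (t : R -> R) :
  Rbar_locally p_infty (fun l => 0 < t l) -> is_lim t p_infty 0 ->
  is_lim (fun l => cos (t l) / sin (t l) - / t l) p_infty 0.
Proof.
  intros Hpos Ht.
  apply (lim_squeeze (fun l => - t l / 2) _ (fun _ => 0)).
  - apply (filter_imp (fun l => 0 < t l < PI / 2));
      [|apply eventually_small_angle; assumption].
    intros l T.
    destruct (sin_cos_bounds _ T) as [[B1 B2] B3].
    assert (S : 0 < sin (t l)) by (apply sin_gt_0; lra).
    assert (ST : 0 < sin (t l) * t l) by (apply Rmult_lt_0_compat; lra).
    replace (cos (t l) / sin (t l) - / t l)
      with ((t l * cos (t l) - sin (t l)) * / (sin (t l) * t l)) by (field; lra).
    split.
    + apply Rmult_le_reg_r with (sin (t l) * t l); [exact ST|].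
      rewrite Rmult_assoc, Rinv_l, Rmult_1_r by lra.
      assert (sin (t l) * (1 - t l ^ 2 / 2) <= sin (t l) * cos (t l))
        by (apply Rmult_le_compat_l; lra).
      assert (sin (t l) * cos (t l) <= t l * cos (t l))
        by (apply Rmult_le_compat_r; [apply cos_ge_0|]; lra).
      nra.
    + apply Rmult_le_reg_r with (sin (t l) * t l); [exact ST|].
      rewrite Rmult_assoc, Rinv_l, Rmult_1_r by lra; lra.
  - lim_here; [lra | field].
  - apply is_lim_const.
Qed.

(* With [t = PI/2 - k r], [U = u(r) = 2 ln (sin t)] and [s t -> C]. *)
Lemma lim_ln_sin (U a s t : R -> R) (C L : R) :
  0 < C ->
  Rbar_locally p_infty (fun l => U l = 2 * ln (sin (t l))) ->
  Rbar_locally p_infty (fun l => 0 < t l) ->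
  Rbar_locally p_infty (fun l => 0 < s l) ->
  is_lim a p_infty p_infty ->
  is_lim t p_infty 0 -> is_lim (fun l => s l * t l) p_infty C ->
  is_lim (fun l => a l * t l * t l) p_infty 0 ->
  is_lim (fun l => a l * (s l * t l - C)) p_infty L ->
  is_lim (fun l => a l * (U l - (2 * ln (1 / s l) + 2 * ln C))) p_infty (2 * L / C).
Proof.
  intros HC HU Hpos Hs Ha Ht Hst Hat HL.
  assert (Ha0 : Rbar_locally p_infty (fun l => 0 < a l)).
  { apply Ha; exists 0; auto. }
  assert (H1 : is_lim (fun l => a l * (s l * sin (t l) - C)) p_infty L).
  { apply lim_scaled_sin; try assumption; apply filter_and; assumption. }
  assert (H2 : is_lim (fun l => a l * ln (s l * sin (t l) / C)) p_infty (L / C)).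
  { apply lim_scaled_ln; [exact Ha|].
    lim_as (fun l => a l * (s l * sin (t l) - C) / C); [lra | | reflexivity].
    apply filter_forall; intros; field; lra. }
  (* The error of [U] is exactly [2 ln (s sin t / C)], which accounts for the factor [2 / C] in the
     limit. *)
  lim_as (fun l => 2 * (a l * ln (s l * sin (t l) / C))); [|field; lra].
  apply (filter_imp (fun l => (U l = 2 * ln (sin (t l)) /\ 0 < s l) /\ 0 < t l < PI / 2));
    [|apply filter_and; [apply filter_and | apply eventually_small_angle];
      assumption].
  intros l [[-> S] T].
  assert (0 < sin (t l)) by (apply sin_gt_0; lra).
  rewrite ln_div, ln_mult by (try apply Rmult_lt_0_compat; assumption).
  replace (1 / s l) with (/ s l) by (field; lra).
  rewrite ln_Rinv by assumption; ring.
Qed.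

(** * Asymptotic expansions *)

(** All that the expansions retain of the boundary value problem; it is [2 k tan k = l] cleared of
    the denominator. *)
Definition freq_equation (k : R -> R) : Prop :=
  forall l, 0 < l -> 0 < k l < PI / 2 /\ 2 * k l * sin (k l) = l * cos (k l).

Definition defect (k : R -> R) (l : R) : R := PI / 2 - k l.

Definition angle (k : R -> R) (p alpha l : R) : R := PI / 2 - k l * r_pt p alpha l.

(** The shift by [PI / 2] exchanges sine and cosine in the equation for [k]; then
    [d cos d <= sin d <= d] encloses [l d], the upper bound after cancelling [cos d > 0]. *)
Lemma defect_bounds (k : R -> R) (l : R) :
  freq_equation k -> 0 < l ->
  0 < defect k l < PI / 2 /\
  l * sin (defect k l) = 2 * k l * cos (defect k l) /\
  2 * k l * cos (defect k l) <= l * defect k l <= 2 * k l.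
Proof.
  intros Hk Hl; destruct (Hk l Hl) as [Hk1 Hk2].
  assert (D : 0 < defect k l < PI / 2) by (unfold defect; lra).
  assert (E : l * sin (defect k l) = 2 * k l * cos (defect k l)).
  { unfold defect; rewrite sin_shift, cos_shift; lra. }
  destruct (sin_cos_bounds _ D) as [[B1 B2] _].
  assert (C : 0 < cos (defect k l)) by (apply cos_gt_0; lra).
  repeat split; try apply D; [exact E | nra |].
  apply Rmult_le_reg_r with (cos (defect k l)); [exact C|].
  rewrite <- E, Rmult_assoc; apply Rmult_le_compat_l; lra.
Qed.

(** * Expansion of the defect to second order *)

Lemma lim_inv_id : is_lim (fun l => / l) p_infty 0.
Proof. apply lim_inv_infty, is_lim_id. Qed.

Lemma lim_defect (k : R -> R) : freq_equation k -> is_lim (defect k) p_infty 0.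
Proof.
  intros Hk; pose proof lim_inv_id as Hi.
  apply (lim_squeeze (fun _ => 0) _ (fun l => PI * / l)).
  - apply (filter_imp _ _) with (2 := eventually_gt 0); intros l Hl.
    destruct (defect_bounds k l Hk Hl) as [D [_ [_ B]]].
    destruct (Hk l Hl) as [Hkl _].
    split; [lra|].
    apply Rmult_le_reg_r with l; [exact Hl|].
    rewrite Rmult_assoc, Rinv_l; lra.
  - apply is_lim_const.
  - lim_here; ring.
Qed.

Lemma lim_freq (k : R -> R) : freq_equation k -> is_lim k p_infty (PI / 2).
Proof.
  intros Hk; pose proof (lim_defect k Hk).
  lim_as (fun l => PI / 2 - defect k l); [|ring].
  apply filter_forall; intros l; unfold defect; ring.
Qed.

Lemma lim_scaled_defect (k : R -> R) :
  freq_equation k -> is_lim (fun l => l * defect k l) p_infty PI.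
Proof.
  intros Hk; pose proof (lim_defect k Hk) as Hd; pose proof (lim_freq k Hk) as Hf.
  apply (lim_squeeze (fun l => 2 * k l * (1 - defect k l * defect k l / 2)) _
                     (fun l => 2 * k l)).
  - apply (filter_imp _ _) with (2 := eventually_gt 0); intros l Hl.
    destruct (defect_bounds k l Hk Hl) as [D [_ [B1 B2]]].
    destruct (Hk l Hl) as [Hkl _].
    split; [|exact B2].
    eapply Rle_trans; [|exact B1].
    destruct (sin_cos_bounds _ D) as [_ B3].
    apply Rmult_le_compat_l; lra.
  - lim_here; [lra | field].
  - lim_here; field.
Qed.

(** With [2 k = PI - 2 d], the bound [l d <= 2 k] gives [l (l d - PI) <= - 2 l d], and [l d] tends
    to [PI]. The lower bound loses only a further [k (l d) d], which vanishes. *)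
Lemma lim_second_order_defect (k : R -> R) :
  freq_equation k ->
  is_lim (fun l => l * (l * defect k l - PI)) p_infty (- 2 * PI).
Proof.
  intros Hk; pose proof (lim_defect k Hk) as Hd; pose proof (lim_freq k Hk) as Hf.
  pose proof (lim_scaled_defect k Hk) as Hld.
  apply (lim_squeeze
    (fun l => - 2 * (l * defect k l) - k l * (l * defect k l) * defect k l) _
    (fun l => - 2 * (l * defect k l))).
  - apply (filter_imp _ _) with (2 := eventually_gt 0); intros l Hl.
    destruct (defect_bounds k l Hk Hl) as [D [_ [B1 B2]]].
    destruct (Hk l Hl) as [Hkl _].
    destruct (sin_cos_bounds _ D) as [_ B3].
    assert (Ek : 2 * k l = PI - 2 * defect k l) by (unfold defect; field).
    split.
    + assert (2 * k l * (1 - defect k l ^ 2 / 2) <= l * defect k l).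
      { eapply Rle_trans; [|exact B1]; apply Rmult_le_compat_l; lra. }
      replace (- 2 * (l * defect k l) - k l * (l * defect k l) * defect k l)
        with (l * (2 * k l * (1 - defect k l ^ 2 / 2) - PI)).
      * apply Rmult_le_compat_l; lra.
      * replace (k l) with ((PI - 2 * defect k l) / 2) by lra; field.
    + replace (- 2 * (l * defect k l)) with (l * (2 * k l - PI)) by (rewrite Ek; ring).
      apply Rmult_le_compat_l; lra.
  - lim_here; ring.
  - lim_here; ring.
Qed.

(** * The angle at distance [p / l^alpha] from the boundary *)

Lemma lim_dist (p alpha : R) :
  0 < alpha -> is_lim (fun l => p / Rpower l alpha) p_infty 0.
Proof.
  intros Ha; pose proof (lim_inv_infty _ (lim_Rpower alpha Ha)) as H.
  lim_as (fun l => p * / Rpower l alpha); [|ring].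
  apply filter_forall; reflexivity.
Qed.

Lemma eventually_r_pt (p alpha : R) :
  0 < alpha -> 0 < p -> Rbar_locally p_infty (fun l => 0 < r_pt p alpha l < 1).
Proof.
  intros Ha Hp.
  apply (filter_imp (fun l => p / Rpower l alpha < 1)).
  - intros l Hl; unfold r_pt.
    assert (0 < p / Rpower l alpha)
      by (apply Rdiv_lt_0_compat; [exact Hp | apply Rpower_pos]).
    lra.
  - apply lim_eventually_lt with 0; [apply lim_dist, Ha | lra].
Qed.

Lemma angle_defect (k : R -> R) (p alpha l : R) :
  angle k p alpha l = defect k l + k l * (p / Rpower l alpha).
Proof. unfold angle, defect, r_pt; ring. Qed.

Lemma eventually_angle_pos (k : R -> R) (p alpha : R) :
  freq_equation k -> 0 < p -> Rbar_locally p_infty (fun l => 0 < angle k p alpha l).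
Proof.
  intros Hk Hp; apply (filter_imp _ _) with (2 := eventually_gt 0); intros l Hl.
  destruct (defect_bounds k l Hk Hl) as [D _]; destruct (Hk l Hl) as [Hkl _].
  rewrite angle_defect.
  assert (0 < k l * (p / Rpower l alpha)).
  { apply Rmult_lt_0_compat; [lra|].
    apply Rdiv_lt_0_compat; [exact Hp | apply Rpower_pos]. }
  lra.
Qed.

Lemma lim_angle (k : R -> R) (p alpha : R) :
  freq_equation k -> 0 < alpha -> is_lim (angle k p alpha) p_infty 0.
Proof.
  intros Hk Ha; pose proof (lim_defect k Hk); pose proof (lim_freq k Hk).
  pose proof (lim_dist p alpha Ha).
  lim_as (fun l => defect k l + k l * (p / Rpower l alpha)); [|ring].
  apply filter_forall; intros l; rewrite angle_defect; reflexivity.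
Qed.

Lemma Rpower_minus (x a b : R) : Rpower x (a - b) = Rpower x a / Rpower x b.
Proof.
  unfold Rminus; rewrite Rpower_plus, Rpower_Ropp; reflexivity.
Qed.

Lemma Rpower_2 (x : R) : 0 < x -> Rpower x 2 = x * x.
Proof.
  intros Hx; replace 2 with (1 + 1) by ring.
  rewrite Rpower_plus, Rpower_1; trivial.
Qed.

(** The two terms have orders 1 and [l^(1 - alpha)], whence the threshold [alpha = 1]. For
    [alpha > 1] the second term competes with the correction [- 2 PI / l] of the first, whence the
    threshold [alpha = 2]. *)
Lemma scaled_angle (k : R -> R) (p alpha l : R) :
  0 < l ->
  l * angle k p alpha l = l * defect k l + k l * p * Rpower l (1 - alpha).
Proof.
  intros Hl; rewrite angle_defect, Rpower_minus, Rpower_1 by exact Hl.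
  field; apply Rgt_not_eq, Rpower_pos.
Qed.

Lemma lim_scaled_angle_gt1 (k : R -> R) (p alpha : R) :
  freq_equation k -> 1 < alpha ->
  is_lim (fun l => l * angle k p alpha l) p_infty PI.
Proof.
  intros Hk Ha.
  pose proof (lim_scaled_defect k Hk); pose proof (lim_freq k Hk).
  assert (is_lim (fun l => Rpower l (1 - alpha)) p_infty 0)
    by (apply lim_Rpower_neg; lra).
  lim_as (fun l => l * defect k l + k l * p * Rpower l (1 - alpha)); [|ring].
  apply (filter_imp _ _) with (2 := eventually_gt 0); intros l Hl.
  rewrite scaled_angle; trivial.
Qed.

Lemma lim_scaled_angle_eq1 (k : R -> R) (p : R) :
  freq_equation k ->
  is_lim (fun l => l * angle k p 1 l) p_infty ((p + 2) * PI / 2).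
Proof.
  intros Hk.
  pose proof (lim_scaled_defect k Hk); pose proof (lim_freq k Hk).
  lim_as (fun l => l * defect k l + k l * p); [|field].
  apply (filter_imp _ _) with (2 := eventually_gt 0); intros l Hl.
  rewrite scaled_angle, Rminus_diag, Rpower_O by exact Hl; ring.
Qed.

Lemma lim_scaled_angle_lt1 (k : R -> R) (p alpha : R) :
  freq_equation k -> alpha < 1 ->
  is_lim (fun l => Rpower l alpha * angle k p alpha l) p_infty (p * PI / 2).
Proof.
  intros Hk Ha.
  pose proof (lim_scaled_defect k Hk); pose proof (lim_freq k Hk).
  assert (is_lim (fun l => Rpower l (alpha - 1)) p_infty 0)
    by (apply lim_Rpower_neg; lra).
  lim_as (fun l => Rpower l (alpha - 1) * (l * defect k l) + k l * p); [|field].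
  apply (filter_imp _ _) with (2 := eventually_gt 0); intros l Hl.
  rewrite angle_defect, Rpower_minus, Rpower_1 by exact Hl.
  field; split; [apply Rgt_not_eq, Rpower_pos | lra].
Qed.

(** * Expansions of [u] at the boundary and at the moving point *)

Lemma lim_ln_endpoint (k U : R -> R) :
  freq_equation k ->
  Rbar_locally p_infty (fun l => U l = 2 * ln (sin (defect k l))) ->
  is_lim (fun l => l * (U l - (2 * ln (1 / l) + 2 * ln PI))) p_infty (- 4).
Proof.
  intros Hk HU; pose proof PI_RGT_0.
  pose proof (lim_defect k Hk); pose proof (lim_scaled_defect k Hk).
  eapply lim_value.
  - apply (lim_ln_sin U (fun l => l) (fun l => l) (defect k) PI (- 2 * PI)); trivial.
    + apply (filter_imp _ _) with (2 := eventually_gt 0); intros l Hl.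
      apply (defect_bounds k l Hk Hl).
    + apply eventually_gt.
    + apply is_lim_id.
    + lim_here; ring.
    + apply lim_second_order_defect, Hk.
  - field; lra.
Qed.

(* Used with [a = l^min(1, alpha - 1)], the inverse scale of the third order term. *)
Lemma lim_ln_interior_gt1 (k U a : R -> R) (p alpha L : R) :
  freq_equation k -> 1 < alpha -> 0 < p ->
  Rbar_locally p_infty (fun l => U l = 2 * ln (sin (angle k p alpha l))) ->
  is_lim a p_infty p_infty ->
  Rbar_locally p_infty (fun l => 0 < a l <= l) ->
  is_lim (fun l => a l * (l * angle k p alpha l - PI)) p_infty L ->
  is_lim (fun l => a l * (U l - (2 * ln (1 / l) + 2 * ln PI))) p_infty (2 * L / PI).
Proof.
  intros Hk Ha Hp HU Hinf Hal HL; pose proof PI_RGT_0.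
  assert (is_lim (angle k p alpha) p_infty 0) by (apply lim_angle; [exact Hk | lra]).
  pose proof (lim_scaled_angle_gt1 k p alpha Hk Ha).
  pose proof (eventually_angle_pos k p alpha Hk Hp) as Hpos.
  apply (lim_ln_sin U a (fun l => l) (angle k p alpha)); trivial.
  - apply eventually_gt.
  (* Because [a <= l], the quantity [a t^2] is at most [(l t) t], where [l t] converges and [t]
     vanishes. *)
  - apply (lim_squeeze (fun _ => 0) _
             (fun l => (l * angle k p alpha l) * angle k p alpha l)).
    + apply (filter_imp _ _) with (2 := filter_and _ _ Hal Hpos); intros l [A T].
      assert (0 < angle k p alpha l * angle k p alpha l)
        by (apply Rmult_lt_0_compat; exact T).
      rewrite !Rmult_assoc; nra.
    + apply is_lim_const.
    + lim_here; ring.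
Qed.

(** At precision [l] the distance contributes [k p l^(2 - alpha)], which vanishes, so the boundary
    value [- 4] survives. *)
Lemma lim_ln_interior_gt2 (k U : R -> R) (p alpha : R) :
  freq_equation k -> 2 < alpha -> 0 < p ->
  Rbar_locally p_infty (fun l => U l = 2 * ln (sin (angle k p alpha l))) ->
  is_lim (fun l => l * (U l - (2 * ln (1 / l) + 2 * ln PI))) p_infty (- 4).
Proof.
  intros Hk Ha Hp HU; pose proof PI_RGT_0.
  eapply lim_value.
  - apply (lim_ln_interior_gt1 k U (fun l => l) p alpha (- 2 * PI)); trivial.
    + lra.
    + apply is_lim_id.
    + apply (filter_imp _ _) with (2 := eventually_gt 0); intros; lra.
    + pose proof (lim_second_order_defect k Hk); pose proof (lim_freq k Hk).
      assert (is_lim (fun l => Rpower l (2 - alpha)) p_infty 0)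
        by (apply lim_Rpower_neg; lra).
      lim_as (fun l => l * (l * defect k l - PI) + k l * p * Rpower l (2 - alpha));
        [|ring].
      apply (filter_imp _ _) with (2 := eventually_gt 0); intros l Hl.
      rewrite scaled_angle by exact Hl.
      replace (2 - alpha) with (1 + (1 - alpha)) by ring.
      rewrite Rpower_plus, Rpower_1 by exact Hl; ring.
  - field; lra.
Qed.

(** Both corrections to [l t] are of order [1 / l]: the defect gives [- 2 PI], the distance
    [p PI / 2], and [2 L / PI = p - 4]. *)
Lemma lim_ln_interior_eq2 (k U : R -> R) (p : R) :
  freq_equation k -> 0 < p ->
  Rbar_locally p_infty (fun l => U l = 2 * ln (sin (angle k p 2 l))) ->
  is_lim (fun l => l * (U l - (2 * ln (1 / l) + 2 * ln PI))) p_infty (p - 4).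
Proof.
  intros Hk Hp HU; pose proof PI_RGT_0.
  eapply lim_value.
  - apply (lim_ln_interior_gt1 k U (fun l => l) p 2 (- 2 * PI + p * PI / 2)); trivial.
    + lra.
    + apply is_lim_id.
    + apply (filter_imp _ _) with (2 := eventually_gt 0); intros; lra.
    + pose proof (lim_second_order_defect k Hk); pose proof (lim_freq k Hk).
      lim_as (fun l => l * (l * defect k l - PI) + k l * p); [|field].
      apply (filter_imp _ _) with (2 := eventually_gt 0); intros l Hl.
      rewrite angle_defect, Rpower_2 by exact Hl; field; lra.
  - field; lra.
Qed.

(** At the coarser precision [l^(alpha - 1)] the correction of the defect shrinks like
    [l^(alpha - 2)], and only the distance term [p PI / 2] remains. *)
Lemma lim_ln_interior_lt2 (k U : R -> R) (p alpha : R) :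
  freq_equation k -> 1 < alpha < 2 -> 0 < p ->
  Rbar_locally p_infty (fun l => U l = 2 * ln (sin (angle k p alpha l))) ->
  is_lim (fun l => Rpower l (alpha - 1) * (U l - (2 * ln (1 / l) + 2 * ln PI)))
    p_infty p.
Proof.
  intros Hk Ha Hp HU; pose proof PI_RGT_0.
  eapply lim_value.
  - apply (lim_ln_interior_gt1 k U (fun l => Rpower l (alpha - 1)) p alpha (p * PI / 2));
      trivial.
    + lra.
    + apply lim_Rpower; lra.
    + apply (filter_imp _ _) with (2 := eventually_gt 1); intros l Hl.
      split; [apply Rpower_pos|].
      rewrite <- (Rpower_1 l) at 2 by lra; apply Rle_Rpower; lra.
    + pose proof (lim_second_order_defect k Hk); pose proof (lim_freq k Hk).
      assert (is_lim (fun l => Rpower l (alpha - 2)) p_infty 0)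
        by (apply lim_Rpower_neg; lra).
      lim_as (fun l => Rpower l (alpha - 2) * (l * (l * defect k l - PI)) + k l * p);
        [|field].
      apply (filter_imp _ _) with (2 := eventually_gt 0); intros l Hl.
      rewrite angle_defect, !Rpower_minus, Rpower_1, Rpower_2 by exact Hl.
      field; split; [apply Rgt_not_eq, Rpower_pos | lra].
  - field; lra.
Qed.

(** Here [l t = l d + k p] with [k = PI / 2 - d], so the scaled error tends to [- 2 PI - p PI]. It
    is proportional to [p + 2], as is [C], and [p] cancels in [2 L / C = - 4]. *)
Lemma lim_ln_interior_eq1 (k U : R -> R) (p : R) :
  freq_equation k -> 0 < p ->
  Rbar_locally p_infty (fun l => U l = 2 * ln (sin (angle k p 1 l))) ->
  is_lim (fun l => l * (U l - (2 * ln (1 / l) + 2 * ln ((p + 2) * PI / 2))))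
    p_infty (- 4).
Proof.
  intros Hk Hp HU; pose proof PI_RGT_0.
  assert (is_lim (angle k p 1) p_infty 0) by (apply lim_angle; [exact Hk | lra]).
  pose proof (lim_scaled_angle_eq1 k p Hk).
  assert (0 < (p + 2) * PI) by (apply Rmult_lt_0_compat; lra).
  eapply lim_value.
  - apply (lim_ln_sin U (fun l => l) (fun l => l) (angle k p 1)
             ((p + 2) * PI / 2) (- (p + 2) * PI)); trivial.
    + lra.
    + apply eventually_angle_pos; assumption.
    + apply eventually_gt.
    + apply is_lim_id.
    + lim_here; ring.
    + pose proof (lim_second_order_defect k Hk); pose proof (lim_scaled_defect k Hk).
      lim_as (fun l => l * (l * defect k l - PI) - p * (l * defect k l)); [|ring].
      apply (filter_imp _ _) with (2 := eventually_gt 0); intros l Hl.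
      rewrite scaled_angle, Rminus_diag, Rpower_O by exact Hl.
      unfold defect; field.
  - field; lra.
Qed.

(** The remainder carries no rate, so continuity of [ln] at 1 takes the place of [lim_scaled_ln],
    whose scale must diverge. *)
Lemma lim_ln_interior_lt1 (k U : R -> R) (p alpha : R) :
  freq_equation k -> 0 < alpha < 1 -> 0 < p ->
  Rbar_locally p_infty (fun l => U l = 2 * ln (sin (angle k p alpha l))) ->
  is_lim (fun l => U l - (2 * alpha * ln (1 / l) + 2 * ln (p * PI / 2))) p_infty 0.
Proof.
  intros Hk Ha Hp HU; pose proof PI_RGT_0.
  assert (HC : 0 < p * PI / 2)
    by (apply Rdiv_lt_0_compat; [apply Rmult_lt_0_compat|]; lra).
  assert (Hlim : is_lim (angle k p alpha) p_infty 0) by (apply lim_angle; [exact Hk | lra]).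
  pose proof (eventually_angle_pos k p alpha Hk Hp) as Hpos.
  assert (is_lim (fun l => Rpower l alpha * sin (angle k p alpha l)) p_infty (p * PI / 2)).
  { apply lim_sin; trivial.
    - apply filter_forall; intros; apply Rpower_pos.
    - apply lim_scaled_angle_lt1; [exact Hk | lra]. }
  assert (Hz : is_lim (fun l => Rpower l alpha * sin (angle k p alpha l) / (p * PI / 2))
                 p_infty 1).
  { lim_here; [lra | field; lra]. }
  pose proof (is_lim_comp_continuous _ ln _ _ Hz (continuous_ln 1 Rlt_0_1)) as Hln.
  rewrite ln_1 in Hln.
  lim_as (fun l => 2 * ln (Rpower l alpha * sin (angle k p alpha l) / (p * PI / 2)));
    [|ring].
  apply (filter_imp _ _) with
    (2 := filter_and _ _ (filter_and _ _ HU (eventually_gt 0))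
            (eventually_small_angle _ Hpos Hlim)).
  intros l [[-> Hl] T].
  assert (0 < sin (angle k p alpha l)) by (apply sin_gt_0; lra).
  pose proof (Rpower_pos l alpha).
  rewrite ln_div, ln_mult, ln_Rpower
    by first [assumption | apply Rmult_lt_0_compat; assumption].
  replace (1 / l) with (/ l) by (field; lra).
  rewrite ln_Rinv by exact Hl; ring.
Qed.

Lemma lim_ln_sin_m_infty (U t : R -> R) :
  Rbar_locally p_infty (fun l => U l = 2 * ln (sin (t l))) ->
  Rbar_locally p_infty (fun l => 0 < t l) -> is_lim t p_infty 0 ->
  is_lim U p_infty m_infty.
Proof.
  intros HU Hpos Ht P [M HM].
  assert (Hs : Rbar_locally p_infty (fun l => t l < exp (M / 2)))
    by (apply lim_eventually_lt with 0; [exact Ht | apply exp_pos]).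
  apply (filter_imp _ _) with
    (2 := filter_and _ _ (filter_and _ _ HU Hs) (eventually_small_angle _ Hpos Ht)).
  intros l [[E T1] T2]; apply HM; rewrite E.
  assert (0 < sin (t l)) by (apply sin_gt_0; lra).
  assert (L : ln (sin (t l)) < M / 2).
  { rewrite <- (ln_exp (M / 2)); apply ln_increasing; [assumption|].
    pose proof (sin_lt_x (t l)); lra. }
  lra.
Qed.

(** * Expansions of [u'] *)

Definition slope (k t : R -> R) (l : R) : R := - (2 * k l) * (cos (t l) / sin (t l)).

Lemma lim_slope_cot (k t : R -> R) :
  freq_equation k -> Rbar_locally p_infty (fun l => 0 < t l) -> is_lim t p_infty 0 ->
  is_lim (fun l => slope k t l + 2 * k l / t l) p_infty 0.
Proof.
  intros Hk Hpos Ht.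
  pose proof (lim_cot t Hpos Ht); pose proof (lim_freq k Hk).
  lim_as (fun l => - (2 * k l) * (cos (t l) / sin (t l) - / t l)); [|ring].
  apply filter_forall; intros l; unfold slope, Rdiv; ring.
Qed.

(** Since [l = 2 k cot d] exactly, [slope + l = 2 k (cot d - cot t) = 2 k sin (t - d) / (sin d sin
    t)] with [t - d = k p / l^alpha]. The identity is exact, so it also serves when [alpha > 2] and
    the difference vanishes; the additive error of [lim_slope_cot] would be too coarse there. *)
Lemma lim_slope_gt1 (k : R -> R) (p alpha : R) :
  freq_equation k -> 1 < alpha -> 0 < p ->
  is_lim (fun l => Rpower l (alpha - 2) * (slope k (angle k p alpha) l + l))
    p_infty (p / 2).
Proof.
  intros Hk Ha Hp; pose proof PI_RGT_0.
  pose proof (lim_freq k Hk) as Hf; pose proof (lim_defect k Hk) as Hd.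
  pose proof (eventually_angle_pos k p alpha Hk Hp) as Hpos.
  assert (Ht : is_lim (angle k p alpha) p_infty 0) by (apply lim_angle; [exact Hk | lra]).
  assert (is_lim (fun l => l * sin (defect k l)) p_infty PI).
  { apply lim_sin; [| apply eventually_gt | exact Hd | apply lim_scaled_defect, Hk].
    apply (filter_imp _ _) with (2 := eventually_gt 0); intros l Hl.
    apply (defect_bounds k l Hk Hl). }
  assert (is_lim (fun l => l * sin (angle k p alpha l)) p_infty PI).
  { apply lim_sin; [exact Hpos | apply eventually_gt | exact Ht |].
    apply lim_scaled_angle_gt1; assumption. }
  assert (is_lim (fun l => Rpower l alpha * sin (k l * (p / Rpower l alpha)))
            p_infty (p * PI / 2)).
  { assert (is_lim (fun l => p / Rpower l alpha) p_infty 0) by (apply lim_dist; lra).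
    apply lim_sin.
    - apply (filter_imp _ _) with (2 := eventually_gt 0); intros l Hl.
      destruct (Hk l Hl) as [Hkl _].
      apply Rmult_lt_0_compat; [lra|].
      apply Rdiv_lt_0_compat; [exact Hp | apply Rpower_pos].
    - apply filter_forall; intros; apply Rpower_pos.
    - lim_here; ring.
    - lim_as (fun l => k l * p); [|field].
      apply filter_forall; intros l; field; apply Rgt_not_eq, Rpower_pos. }
  lim_as (fun l => 2 * k l * (Rpower l alpha * sin (k l * (p / Rpower l alpha)))
                   / ((l * sin (defect k l)) * (l * sin (angle k p alpha l))));
    [apply Rmult_integral_contrapositive; lra | | field; lra].
  apply (filter_imp _ _) with
    (2 := filter_and _ _ (eventually_gt 0) (eventually_small_angle _ Hpos Ht)).
  intros l [Hl T].
  destruct (defect_bounds k l Hk Hl) as [D [E _]].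
  assert (0 < sin (angle k p alpha l)) by (apply sin_gt_0; lra).
  assert (0 < sin (defect k l)) by (apply sin_gt_0; lra).
  replace (k l * (p / Rpower l alpha)) with (angle k p alpha l - defect k l)
    by (rewrite angle_defect; ring).
  rewrite sin_minus, Rpower_minus, Rpower_2 by exact Hl; unfold slope.
  transitivity (Rpower l alpha / (l * l) *
    (- (2 * k l) * (cos (angle k p alpha l) / sin (angle k p alpha l))
     + 2 * k l * cos (defect k l) / sin (defect k l))).
  - field; lra.
  - rewrite <- E; field; lra.
Qed.

(** Replacing [2 k / t] by [2 l / (p + 2)] leaves a multiple of
    [l (l t - k (p + 2)) = l (l d - 2 k)]. This is [l (l d - PI) + 2 l d], whose limits [- 2 PI] and
    [2 PI] cancel. *)
Lemma lim_slope_eq1 (k : R -> R) (p : R) :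
  freq_equation k -> 0 < p ->
  is_lim (fun l => slope k (angle k p 1) l + 2 / (p + 2) * l) p_infty 0.
Proof.
  intros Hk Hp; pose proof PI_RGT_0.
  assert (0 < (p + 2) * PI) by (apply Rmult_lt_0_compat; lra).
  pose proof (eventually_angle_pos k p 1 Hk Hp) as Hpos.
  assert (Ht : is_lim (angle k p 1) p_infty 0) by (apply lim_angle; [exact Hk | lra]).
  pose proof (lim_slope_cot k _ Hk Hpos Ht).
  pose proof (lim_scaled_angle_eq1 k p Hk).
  pose proof (lim_second_order_defect k Hk); pose proof (lim_scaled_defect k Hk).
  lim_as (fun l => (slope k (angle k p 1) l + 2 * k l / angle k p 1 l)
    + 2 * (l * (l * defect k l - PI) + 2 * (l * defect k l))
      / ((l * angle k p 1 l) * (p + 2))).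
  - apply Rmult_integral_contrapositive; lra.
  - apply (filter_imp _ _) with (2 := filter_and _ _ Hpos (eventually_gt 0)).
    intros l [T Hl].
    replace (l * (l * defect k l - PI) + 2 * (l * defect k l))
      with (l * (l * angle k p 1 l - k l * (p + 2))).
    + field; lra.
    + rewrite scaled_angle, Rminus_diag, Rpower_O by exact Hl.
      unfold defect; field.
  - field; lra.
Qed.

Lemma lim_slope_lt1 (k : R -> R) (p alpha : R) :
  freq_equation k -> 0 < alpha < 1 -> 0 < p ->
  is_lim (fun l => / Rpower l alpha * slope k (angle k p alpha) l) p_infty (- (2 / p)).
Proof.
  intros Hk Ha Hp; pose proof PI_RGT_0.
  assert (0 < p * PI) by (apply Rmult_lt_0_compat; lra).
  pose proof (eventually_angle_pos k p alpha Hk Hp) as Hpos.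
  assert (Ht : is_lim (angle k p alpha) p_infty 0) by (apply lim_angle; [exact Hk | lra]).
  pose proof (lim_slope_cot k _ Hk Hpos Ht); pose proof (lim_freq k Hk).
  assert (is_lim (fun l => / Rpower l alpha) p_infty 0)
    by (apply lim_inv_infty, lim_Rpower; lra).
  assert (is_lim (fun l => Rpower l alpha * angle k p alpha l) p_infty (p * PI / 2))
    by (apply lim_scaled_angle_lt1; [exact Hk | lra]).
  lim_as (fun l =>
    / Rpower l alpha * (slope k (angle k p alpha) l + 2 * k l / angle k p alpha l)
    - 2 * k l / (Rpower l alpha * angle k p alpha l)); [lra | | field; lra].
  apply (filter_imp _ _) with (2 := Hpos); intros l T; field.
  pose proof (Rpower_pos l alpha); lra.
Qed.

(** Replacing [2 k / t] by [(2 / p) l^alpha] leaves [(2 / p) l^alpha d / t], which is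
    [l^(2 alpha - 1)] times a quantity tending to [4 / p^2]. It vanishes exactly when
    [alpha < 1 / 2]. *)
Lemma lim_slope_lt_half (k : R -> R) (p alpha : R) :
  freq_equation k -> 0 < alpha < 1 / 2 -> 0 < p ->
  is_lim (fun l => slope k (angle k p alpha) l + 2 / p * Rpower l alpha) p_infty 0.
Proof.
  intros Hk Ha Hp; pose proof PI_RGT_0.
  assert (0 < p * PI) by (apply Rmult_lt_0_compat; lra).
  pose proof (eventually_angle_pos k p alpha Hk Hp) as Hpos.
  assert (Ht : is_lim (angle k p alpha) p_infty 0) by (apply lim_angle; [exact Hk | lra]).
  pose proof (lim_slope_cot k _ Hk Hpos Ht); pose proof (lim_scaled_defect k Hk).
  assert (is_lim (fun l => Rpower l (2 * alpha - 1)) p_infty 0)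
    by (apply lim_Rpower_neg; lra).
  assert (is_lim (fun l => Rpower l alpha * angle k p alpha l) p_infty (p * PI / 2))
    by (apply lim_scaled_angle_lt1; [exact Hk | lra]).
  lim_as (fun l => (slope k (angle k p alpha) l + 2 * k l / angle k p alpha l)
    + 2 * (Rpower l (2 * alpha - 1) * (l * defect k l))
      / (p * (Rpower l alpha * angle k p alpha l))).
  - apply Rmult_integral_contrapositive; lra.
  - apply (filter_imp _ _) with (2 := filter_and _ _ Hpos (eventually_gt 0)).
    intros l [T Hl]; pose proof (Rpower_pos l alpha).
    assert (E : angle k p alpha l - defect k l = k l * p / Rpower l alpha)
      by (rewrite angle_defect; field; lra).
    (* [field] sees the angle and the defect as unrelated atoms; eliminating [k] in their favour
       makes the identity purely algebraic. *)
    replace (k l) with ((angle k p alpha l - defect k l) * Rpower l alpha / p)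
      by (rewrite E; field; lra).
    rewrite Rpower_minus, Rpower_1 by exact Hl.
    replace (2 * alpha) with (alpha + alpha) by ring; rewrite Rpower_plus.
    field; lra.
  - field; lra.
Qed.

(** * From limits to statements with [o] *)

Lemma blows_up_m_infty (f : R -> R) : is_lim f p_infty m_infty -> blows_up f.
Proof. apply is_lim_Rabs. Qed.

(** The witness [a f / c - 1] is the relative error of [f] against [c / a]; dividing by [c]
    restricts this to a nonzero leading coefficient. *)
Lemma with_o_relative (E : R -> R -> Prop) (a f : R -> R) (c : R) :
  c <> 0 -> Rbar_locally p_infty (fun l => 0 < a l) ->
  is_lim (fun l => a l * f l) p_infty c ->
  Rbar_locally p_infty (fun l => forall o, f l = c / a l * (1 + o) -> E l o) ->
  with_o E.
Proof.
  intros Hc Ha Hlim HE.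
  exists (fun l => a l * f l / c - 1); split.
  - lim_here; [exact Hc | field; exact Hc].
  - apply (filter_imp _ _) with (2 := filter_and _ _ Ha HE).
    intros l [A H]; apply H; field; lra.
Qed.

Lemma lim_slope_ratio (k : R -> R) (p alpha : R) :
  freq_equation k -> 1 < alpha -> 0 < p ->
  is_lim (fun l => slope k (angle k p alpha) l / - l) p_infty 1.
Proof.
  intros Hk Ha Hp; pose proof (lim_slope_gt1 k p alpha Hk Ha Hp).
  assert (is_lim (fun l => Rpower l (1 - alpha)) p_infty 0)
    by (apply lim_Rpower_neg; lra).
  lim_as (fun l => 1 - Rpower l (1 - alpha)
                       * (Rpower l (alpha - 2) * (slope k (angle k p alpha) l + l)));
    [|ring].
  apply (filter_imp _ _) with (2 := eventually_gt 0); intros l Hl.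
  rewrite !Rpower_minus, Rpower_1, Rpower_2 by exact Hl.
  field; split; [lra | apply Rgt_not_eq, Rpower_pos].
Qed.

Lemma scaled_dist (p alpha l : R) :
  0 < l -> 0 < p -> l ^ 2 * Rabs (r_pt p alpha l - 1) = p * Rpower l (2 - alpha).
Proof.
  intros Hl Hp; unfold r_pt.
  assert (0 < p / Rpower l alpha)
    by (apply Rdiv_lt_0_compat; [exact Hp | apply Rpower_pos]).
  rewrite Rabs_left, Rpower_minus, Rpower_2 by lra.
  field; apply Rgt_not_eq, Rpower_pos.
Qed.

(** The quantity equals [p l^(2 - alpha)]; for [alpha <= 2] it stays at least [p] once [l >= 1]. *)
Lemma scaled_dist_tends_to_0 (p alpha : R) :
  0 < p ->
  2 < alpha <-> tends_to_0 (fun l => l ^ 2 * Rabs (r_pt p alpha l - 1)).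
Proof.
  intros Hp; split.
  - intros Ha.
    assert (is_lim (fun l => Rpower l (2 - alpha)) p_infty 0)
      by (apply lim_Rpower_neg; lra).
    unfold tends_to_0; lim_as (fun l => p * Rpower l (2 - alpha)); [|ring].
    apply (filter_imp _ _) with (2 := eventually_gt 0); intros l Hl.
    rewrite scaled_dist; trivial.
  - intros Hlim.
    destruct (Rlt_or_le 2 alpha) as [h|h]; [exact h | exfalso].
    pose proof (lim_eventually_lt _ 0 p Hlim Hp) as Hlt.
    destruct (filter_and _ _ Hlt (eventually_gt 1)) as [M HM].
    destruct (HM (M + 1)) as [H1 H2]; [lra|].
    rewrite scaled_dist in H1 by lra.
    assert (1 <= Rpower (M + 1) (2 - alpha)).
    { rewrite <- (Rpower_O (M + 1)) at 1 by lra; apply Rle_Rpower; lra. }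
    nra.
Qed.

(** For [alpha = 2] and [p = 4] the coefficient of [1 / l] vanishes and a factor [1 + o] would
    assert an exact equality, so the remainder is written [o / l]. For [alpha < 1] the remainder of
    [u'] is relative, and additive only below [1 / 2], since the next term has order
    [l^(2 alpha - 1)]. *)
Theorem theorem2p2 :
  forall u u' : R -> R -> R,
  (forall lambda, 0 < lambda -> is_solution lambda (u lambda) (u' lambda)) ->
  with_o (fun l o => u l 1 = 2 * ln (1 / l) + 2 * ln PI - 4 / l * (1 + o)) /\
  (forall alpha p : R, 0 < alpha -> 0 < p ->
    let r := r_pt p alpha in
    blows_up (fun l => u l (r l)) /\
    (2 < alpha <-> tends_to_0 (fun l => l ^ 2 * Rabs (r l - 1))) /\
    (* (a) *)
    (2 < alpha ->
      with_o (fun l o =>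
        u l (r l) = - 2 * ln l + 2 * ln PI - 4 / l * (1 + o)) /\
      same_leading_term (fun l => u' l (r l)) (fun l => u' l 1) /\
      blows_up (fun l => u' l (r l)) /\
      blows_up (fun l => u' l 1) /\
      tends_to_0 (fun l => Rabs (u' l (r l) - u' l 1))) /\
    (* (b) *)
    (1 < alpha <= 2 ->
      (alpha = 2 -> p <> 4 ->
        with_o (fun l o =>
          u l (r l) = 2 * ln (1 / l) + 2 * ln PI + (p - 4) / l * (1 + o))) /\
      (alpha = 2 -> p = 4 ->
        with_o (fun l o =>
          u l (r l) = 2 * ln (1 / l) + 2 * ln PI + (p - 4) / l + o / l)) /\
      (alpha < 2 ->
        with_o (fun l o =>
          u l (r l) =
            2 * ln (1 / l) + 2 * ln PI + p / Rpower l (alpha - 1) * (1 + o))) /\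
      same_leading_term (fun l => u' l (r l)) (fun l => u' l 1) /\
      with_o (fun l o =>
        u' l (r l) = - l + p / 2 * Rpower l (2 - alpha) * (1 + o))) /\
    (* (c) *)
    (alpha = 1 ->
      same_leading_term (fun l => u l (r l)) (fun l => u l 1) /\
      with_o (fun l o =>
        u l (r l) =
          2 * ln (1 / l) + 2 * ln ((p + 2) * PI / 2) - 4 / l * (1 + o)) /\
      with_o (fun l o => u' l (r l) = - (2 / (p + 2)) * l + o)) /\
    (* (d) *)
    (alpha < 1 ->
      with_o (fun l o =>
        u l (r l) = 2 * alpha * ln (1 / l) + 2 * ln (p * PI / 2) + o) /\
      with_o (fun l o =>
        u' l (r l) = - (2 / p) * Rpower l alpha * (1 + o)) /\
      (alpha < 1 / 2 ->
        with_o (fun l o =>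
          u' l (r l) = - (2 / p) * Rpower l alpha + o)))).
Proof.
  intros u u' Hsol.
  set (k := fun l => freq l (u l)).
  assert (Hk : freq_equation k).
  { intros l Hl; destruct (solution_formula l _ _ Hl (Hsol l Hl)) as [H1 [H2 _]].
    split; assumption. }
  assert (formula : forall l x, 0 < l -> I01 x ->
    u l x = 2 * ln (sin (PI / 2 - k l * x)) /\
    u' l x = - (2 * k l) * (cos (PI / 2 - k l * x) / sin (PI / 2 - k l * x))).
  { intros l x Hl Hx.
    destruct (solution_formula l _ _ Hl (Hsol l Hl)) as [_ [_ H]].
    rewrite sin_shift, cos_shift; apply (H x Hx). }
  assert (I1 : I01 1) by (unfold I01; lra).
  assert (u1 : Rbar_locally p_infty (fun l => u l 1 = 2 * ln (sin (defect k l)))).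
  { apply (filter_imp _ _) with (2 := eventually_gt 0); intros l Hl.
    destruct (formula l 1 Hl I1) as [-> _]; unfold defect; rewrite Rmult_1_r.
    reflexivity. }
  (* Exact, not asymptotic: [l sin d = 2 k cos d] says [2 k cot d = l]. *)
  assert (u'1 : Rbar_locally p_infty (fun l => u' l 1 = - l)).
  { apply (filter_imp _ _) with (2 := eventually_gt 0); intros l Hl.
    destruct (formula l 1 Hl I1) as [_ ->]; rewrite Rmult_1_r.
    destruct (defect_bounds k l Hk Hl) as [D [E _]]; fold (defect k l).
    assert (0 < sin (defect k l)) by (apply sin_gt_0; lra).
    transitivity (- (2 * k l * cos (defect k l)) / sin (defect k l)); [field; lra|].
    rewrite <- E; field; lra. }
  pose proof (lim_ln_endpoint k (fun l => u l 1) Hk u1) as lim_u1.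
  split.
  { apply (with_o_relative _ _ _ _) with (3 := lim_u1); [lra | apply eventually_gt |].
    apply filter_forall; intros l o E; lra. }
  intros alpha p Ha Hp r.
  assert (Hr : Rbar_locally p_infty (fun l => 0 < l /\ I01 (r l))).
  { apply filter_and; [apply eventually_gt|].
    apply (filter_imp _ _) with (2 := eventually_r_pt p alpha Ha Hp).
    unfold I01, r; intros; lra. }
  assert (ur : Rbar_locally p_infty
                 (fun l => u l (r l) = 2 * ln (sin (angle k p alpha l)))).
  { apply (filter_imp _ _) with (2 := Hr); intros l [Hl HI].
    apply (formula l (r l) Hl HI). }
  assert (u'r : Rbar_locally p_infty
                  (fun l => slope k (angle k p alpha) l = u' l (r l))).
  { apply (filter_imp _ _) with (2 := Hr); intros l [Hl HI].
    symmetry; apply (formula l (r l) Hl HI). }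
  pose proof (lim_angle k p alpha Hk Ha) as lim_t.
  pose proof (eventually_angle_pos k p alpha Hk Hp) as t_pos.
  assert (slopes : 1 < alpha ->
            same_leading_term (fun l => u' l (r l)) (fun l => u' l 1)).
  { intros Ha1; pose proof (lim_slope_ratio k p alpha Hk Ha1 Hp) as H.
    eapply lim_ext; [exact H | | reflexivity].
    apply (filter_imp _ _) with (2 := filter_and _ _ u'1 u'r).
    intros l [-> ->]; reflexivity. }
  split; [|split; [|split; [|split; [|split]]]].
  - apply blows_up_m_infty, lim_ln_sin_m_infty with (angle k p alpha); assumption.
  - apply scaled_dist_tends_to_0, Hp.
  - intros Ha2.
    assert (lim_diff : is_lim (fun l => slope k (angle k p alpha) l + l) p_infty 0).
    { pose proof (lim_slope_gt1 k p alpha Hk ltac:(lra) Hp).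
      assert (is_lim (fun l => Rpower l (2 - alpha)) p_infty 0)
        by (apply lim_Rpower_neg; lra).
      lim_as (fun l => Rpower l (2 - alpha)
                * (Rpower l (alpha - 2) * (slope k (angle k p alpha) l + l)));
        [|ring].
      apply (filter_imp _ _) with (2 := eventually_gt 0); intros l Hl.
      rewrite !Rpower_minus, !Rpower_2 by exact Hl.
      field; split; [lra | apply Rgt_not_eq, Rpower_pos]. }
    assert (lim_neg : is_lim (fun l => - l) p_infty m_infty)
      by (apply (is_lim_opp _ p_infty p_infty), is_lim_id).
    split; [|split; [|split; [|split]]].
    + apply (with_o_relative _ _ _ _) with
        (3 := lim_ln_interior_gt2 k (fun l => u l (r l)) p alpha Hk Ha2 Hp ur);
        [lra | apply eventually_gt |].
      apply (filter_imp _ _) with (2 := eventually_gt 0); intros l Hl o E.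
      replace (1 / l) with (/ l) in E by (field; lra).
      rewrite ln_Rinv in E by exact Hl; lra.
    + apply slopes; lra.
    + apply blows_up_m_infty.
      apply (is_lim_ext_loc (fun l => (slope k (angle k p alpha) l + l) + - l)).
      * apply (filter_imp _ _) with (2 := u'r); intros l <-; ring.
      * eapply is_lim_plus; [exact lim_diff | exact lim_neg | reflexivity].
    + apply blows_up_m_infty.
      apply (is_lim_ext_loc (fun l => - l)); [|exact lim_neg].
      apply (filter_imp _ _) with (2 := u'1); intros l ->; reflexivity.
    + pose proof (is_lim_Rabs _ _ _ lim_diff) as H0; simpl in H0.
      rewrite Rabs_R0 in H0.
      eapply lim_ext; [exact H0 | | reflexivity].
      apply (filter_imp _ _) with (2 := filter_and _ _ u'1 u'r).
      intros l [-> ->]; f_equal; ring.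
  - intros [Ha1 Ha2]; split; [|split; [|split; [|split]]].
    + intros -> Hp4.
      apply (with_o_relative _ _ _ _) with
        (3 := lim_ln_interior_eq2 k (fun l => u l (r l)) p Hk Hp ur);
        [lra | apply eventually_gt |].
      apply filter_forall; intros l o E; lra.
    + intros -> Hp4.
      pose proof (lim_ln_interior_eq2 k (fun l => u l (r l)) p Hk Hp ur) as H.
      (* The scaled error itself is the witness: its limit [p - 4] is 0. *)
      exists (fun l => l * (u l (r l) - (2 * ln (1 / l) + 2 * ln PI))); split.
      * eapply lim_value; [exact H | lra].
      * apply (filter_imp _ _) with (2 := eventually_gt 0); intros l Hl.
        rewrite Hp4; field; lra.
    + intros Ha3.
      apply (with_o_relative _ _ _ _) with
        (3 := lim_ln_interior_lt2 k (fun l => u l (r l)) p alpha Hk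
                (conj Ha1 Ha3) Hp ur);
        [lra | apply filter_forall; intros; apply Rpower_pos |].
      apply filter_forall; intros l o E; lra.
    + apply slopes, Ha1.
    + apply (with_o_relative _ _ _ _) with (3 := lim_slope_gt1 k p alpha Hk Ha1 Hp);
        [lra | apply filter_forall; intros; apply Rpower_pos |].
      apply (filter_imp _ _) with (2 := u'r); intros l <- o E.
      replace (2 - alpha) with (- (alpha - 2)) by ring.
      rewrite Rpower_Ropp; lra.
  - intros ->.
    pose proof (lim_ln_interior_eq1 k (fun l => u l (r l)) p Hk Hp ur) as lim_ur.
    cbv beta in lim_u1, lim_ur.
    split; [|split].
    + assert (u1_inf : is_lim (fun l => u l 1) p_infty m_infty).
      { apply lim_ln_sin_m_infty with (defect k); [exact u1 | | apply lim_defect, Hk].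
        apply (filter_imp _ _) with (2 := eventually_gt 0); intros l Hl.
        apply (defect_bounds k l Hk Hl). }
      assert (u1_neg : Rbar_locally p_infty (fun l => u l 1 < 0))
        by (apply (u1_inf (fun y => y < 0)); exists 0; auto).
      assert (is_lim (fun l => / u l 1) p_infty 0)
        by (apply (is_lim_inv _ p_infty m_infty u1_inf); discriminate).
      pose proof lim_inv_id.
      unfold same_leading_term.
      (* The ratio is [1 + (u (r) - u (1)) / u (1)]. The terms [2 ln (1 / l)] cancel in the
         numerator, which converges to a constant, while [u (1)] diverges. *)
      lim_as (fun l => 1 +
        ((l * (u l (r l) - (2 * ln (1 / l) + 2 * ln ((p + 2) * PI / 2)))) * / l
         - (l * (u l 1 - (2 * ln (1 / l) + 2 * ln PI))) * / l
         + (2 * ln ((p + 2) * PI / 2) - 2 * ln PI)) * / u l 1); [|ring].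
      apply (filter_imp _ _) with (2 := filter_and _ _ u1_neg (eventually_gt 0)).
      intros l [N Hl]; field; lra.
    + apply (with_o_relative _ _ _ _) with (3 := lim_ur);
        [lra | apply eventually_gt |].
      apply filter_forall; intros l o E; lra.
    + exists (fun l => slope k (angle k p 1) l + 2 / (p + 2) * l); split.
      * apply lim_slope_eq1; assumption.
      * apply (filter_imp _ _) with (2 := u'r); intros l <-; ring.
  - intros Ha1; split; [|split].
    + pose proof (lim_ln_interior_lt1 k (fun l => u l (r l)) p alpha Hk
                    (conj Ha Ha1) Hp ur) as H.
      eexists; split; [exact H|].
      apply filter_forall; intros l; ring.
    + apply (with_o_relative _ _ _ _) with
        (3 := lim_slope_lt1 k p alpha Hk (conj Ha Ha1) Hp).
      * assert (0 < 2 / p) by (apply Rdiv_lt_0_compat; lra); lra.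
      * apply filter_forall; intros; apply Rinv_0_lt_compat, Rpower_pos.
      * apply (filter_imp _ _) with (2 := u'r); intros l -> o ->.
        unfold Rdiv at 1; rewrite Rinv_inv; ring.
    + intros Hhalf.
      exists (fun l => slope k (angle k p alpha) l + 2 / p * Rpower l alpha); split.
      * apply lim_slope_lt_half; [exact Hk | lra | exact Hp].
      * apply (filter_imp _ _) with (2 := u'r); intros l <-; ring.
Qed.
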